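(* Let $X\subset S^{d-1}$ be a kissing configuration and let $C\subset S^{d-1}\setminus X$ be a finite set. For $c\in C$ put $F(c)=\{x\in X:\langle c,x\rangle>1/2\}$, and for $I\subseteq C$ put $F(I)=\bigcup_{c\in I}F(c)$. Consider the graph on $C$ in which two distinct candidates are joined when their inner product exceeds $1/2$. For $D\subseteq X$ and $I\subseteq C$, the set $(X\setminus D)\cup I$ is a kissing configuration if and only if $I$ is independent in this graph and $F(I)\subseteq D$. In particular, for independent $I$, the largest configuration of this form with inserted set $I$ is $$X_I=(X\setminus F(I))\cup I,\qquad\text{and}\qquad |X_I|-|X|=|I|-|F(I)| .$$ More generally, for a positive weight function $w$ on $X\cup C$ and independent $I$, the greatest weight gain with inserted set $I$, i.e. the maximum of $w((X\setminus D)\cup I)-w(X)$ over $D\subseteq X$ such that $(X\setminus D)\cup I$ is a kissing configuration, is $w(I)-w(F(I))$, where $w(A)=\sum_{a\in A}w(a)$.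
   Context: A kissing configuration in $S^{d-1}\subset\mathbb{R}^d$ is a set of unit vectors whose distinct members have inner product at most $\tfrac12$. *)

(* Defs.v *)
From mathcomp Require Import all_boot all_order all_algebra.
From mathcomp Require Import finmap all_classical all_reals.
From mathcomp Require Import lra zify.

Set Implicit Arguments.
Unset Strict Implicit.
Unset Printing Implicit Defensive.

Import Order.TTheory GRing.Theory Num.Theory.
Local Open Scope classical_set_scope.
Local Open Scope ring_scope.

Section Kissing.
Variables (R : realType) (d : nat).
Implicit Types (x y c : 'rV[R]_d) (A X C D I : set 'rV[R]_d).

Definition dot x y : R := \sum_(i < d) x 0 i * y 0 i.

(* MathComp-Analysis norms 'rV[R]_d by the sup norm, hence the explicit
   Euclidean norm. *)
Definition enorm x : R := Num.sqrt (dot x x).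

Definition unit_sphere : set 'rV[R]_d := [set x | enorm x = 1].

Definition kissing X :=
  X `<=` unit_sphere /\
  forall x y, X x -> X y -> x <> y -> dot x y <= 1 / 2.

Definition forced X c : set 'rV[R]_d := [set x | X x /\ 1 / 2 < dot c x].

Definition forced_set X I : set 'rV[R]_d := \bigcup_(c in I) forced X c.

Definition conflict C c c' := [/\ C c, C c', c <> c' & 1 / 2 < dot c c'].

Definition independent (E : 'rV[R]_d -> 'rV[R]_d -> Prop) I :=
  forall c c', I c -> I c' -> ~ E c c'.

Definition kissing_exchanges X I : set (set 'rV[R]_d) :=
  [set Y | kissing Y /\ exists2 D, D `<=` X & Y = (X `\` D) `|` I].

(* [fset_set] and [\sum_(_ \in _)] are only meaningful on finite sets; see
   [kissing_finite] below. *)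
Definition set_card A : nat := #|` fset_set A|%fset.

Definition weight (w : 'rV[R]_d -> R) A : R := \sum_(a \in A) w a.

(* Largest both for inclusion and, strictly, for cardinality. *)
Definition is_largest (S : set (set 'rV[R]_d)) A :=
  S A /\ forall B, S B -> B `<=` A /\ (B <> A -> (set_card B < set_card A)%N).

Definition is_maximum (G : set R) (m : R) := G m /\ ubound G m.

Lemma kissing_finite X : kissing X -> finite_set X.
Proof.
move=> [Xu Xk]; pose N := d.+1.
have dot1 x : X x -> dot x x = 1.
  move=> /Xu; rewrite /unit_sphere /= /enorm => x1.
  rewrite -[LHS]sqr_sqrtr ?x1 ?expr1n //.
  by apply: sumr_ge0 => i _; rewrite -expr2 sqr_ge0.
have le1 x i : X x -> `|x 0 i| <= 1.
  move=> Xx; rewrite -(@ler_pXn2r _ 2) ?nnegrE // expr1n real_normK ?num_real //.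
  rewrite -(dot1 _ Xx) /dot (bigD1 i) //= expr2 lerDl.
  by apply: sumr_ge0 => j _; rewrite -expr2 sqr_ge0.
pose f x i := Num.floor (x 0 i * N%:R + N%:R).
pose cell x : {ffun 'I_d -> 'I_(2 * N).+1} := [ffun i => inord `|f x i|%N].
have fP x i : X x -> (0 <= f x i <= (2 * N)%N%:Z).
  move=> Xx; have := le1 x i Xx; rewrite ler_norml => /andP[lo hi].
  have N0 : 0 <= N%:R :> R by [].
  rewrite /f floor_ge0 -ltzD1 floor_lt_int; apply/andP; split; first by nra.
  rewrite intrD -!pmulrn natrM; nra.
have cell_inj : {in X &, injective cell}.
  move=> x y /set_mem Xx /set_mem Xy exy; apply: contrapT => nxy.
  have fxy i : f x i = f y i.
    have /andP[x0 x1] := fP x i Xx; have /andP[y0 y1] := fP y i Xy.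
    have := congr1 (fun g : {ffun 'I_d -> 'I_(2 * N).+1} => g i : nat) exy; rewrite !ffunE /=.
    rewrite !inordK ?ltnS -?lez_nat ?gez0_abs// => /(congr1 Posz).
    by rewrite !gez0_abs.
  have d1 i : (x 0 i - y 0 i) ^+ 2 <= (N%:R ^+ 2)^-1.
    have /andP[] := floor_itv (x 0 i * N%:R + N%:R).
    have /andP[] := floor_itv (y 0 i * N%:R + N%:R).
    rewrite -/(f x i) -/(f y i) fxy !intrD => a1 a2 a3 a4.
    have N0 : 0 < N%:R :> R by [].
    rewrite -[leRHS]mul1r ler_pdivlMr ?exprn_gt0 // -exprMn.
    have : `|(x 0 i - y 0 i) * N%:R| <= 1 by rewrite ler_norml; nra.
    by move=> h; rewrite -real_normK ?num_real // exprn_ile1.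
  have : \sum_(i < d) (x 0 i - y 0 i) ^+ 2 < 1.
    apply: le_lt_trans (ler_sum _ (fun i _ => d1 i)) _.
    rewrite sumr_const card_ord -[_ *+ _]mulr_natl ltr_pdivrMr ?exprn_gt0 // mul1r.
    rewrite -natrX ltr_nat /N; nia.
  have -> : \sum_(i < d) (x 0 i - y 0 i) ^+ 2 = dot x x - 2 * dot x y + dot y y.
    rewrite /dot mulr_sumr -sumrB -big_split /=.
    by apply: eq_bigr => i _; rewrite sqrrB; lra.
  have := Xk _ _ Xx Xy nxy; rewrite !dot1 //; lra.
by rewrite -(eq_finite_set (inj_card_eq cell_inj)); exact: finite_finset.
Qed.

End Kissing.

Arguments unit_sphere : clear implicits.

(* Main.v *)
(** An inserted point c lies outside X, so it can only clash with the points of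
    F(c) and with other inserted points; hence (X \ D) u I is kissing exactly
    when I is independent and D contains F(I).  For such D the measure of
    (X \ D) u I exceeds that of X by the measure of I minus that of D, which is
    greatest when D = F(I). *)
Require Import Defs.
From mathcomp Require Import all_boot all_order all_algebra.
From mathcomp Require Import finmap all_classical all_reals.
From mathcomp Require Import zify lra.

Set Implicit Arguments.
Unset Strict Implicit.
Unset Printing Implicit Defensive.

Import Order.TTheory GRing.Theory Num.Theory.
Local Open Scope classical_set_scope.
Local Open Scope ring_scope.

Lemma fsbig_setD_sub (T : Type) (idx : T) (op : Monoid.com_law idx)
    (K : choiceType) (A B : set K) (F : K -> T) :
  finite_set A -> B `<=` A ->
  \big[op/idx]_(a \in A) F a =
  op (\big[op/idx]_(a \in B) F a) (\big[op/idx]_(a \in A `\` B) F a).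
Proof. by move=> Af BA; rewrite (fsbigID B) // setIidr // -setDE. Qed.

(** Splitting [A] into [D] and its complement gives the exchange balance. A general commutative law
    serves both cardinalities ([addn]) and weights ([+%R]); without inverses, the removed part is
    added on the left. *)
Lemma fsbig_exchange (T : Type) (idx : T) (op : Monoid.com_law idx)
    (K : choiceType) (A D I : set K) (F : K -> T) :
  finite_set A -> finite_set I -> D `<=` A -> A `&` I = set0 ->
  op (\big[op/idx]_(a \in (A `\` D) `|` I) F a) (\big[op/idx]_(a \in D) F a) =
  op (\big[op/idx]_(a \in A) F a) (\big[op/idx]_(a \in I) F a).
Proof.
move=> Af If DA AI0; rewrite fsbigU//; last 2 first.
- exact: finite_setD.
- by move=> a [[Aa _] Ia]; have : (A `&` I) a by []; rewrite AI0.
by rewrite (fsbig_setD_sub _ _ Af DA) Monoid.mulmAC; congr (op _ _); exact: Monoid.mulmC.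
Qed.

Section Exchange.
Variables (R : realType) (d : nat).
Implicit Types (x y c : 'rV[R]_d) (X C D I A B : set 'rV[R]_d).

Lemma dotC x y : dot x y = dot y x.
Proof. by apply: eq_bigr => i _; rewrite mulrC. Qed.

(** Lets [fsbig_exchange] count points, with constant weight 1. *)
Lemma set_cardE A :
  finite_set A -> set_card A = \big[addn/0%N]_(a \in A) 1%N.
Proof. by move=> Af; rewrite /set_card card_fset_sum1 fsbig_finite // big_seq_fsetE. Qed.

Lemma ltn_set_card A B :
  finite_set B -> A `<=` B -> A <> B -> (set_card A < set_card B)%N.
Proof.
move=> Bf AB nAB; have Af := sub_finite_set AB Bf.
apply: fproper_ltn_card; rewrite fproperEneq; apply/andP; split.
  by apply/eqP => /(fset_set_inj Af Bf).
by rewrite -fset_set_sub.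
Qed.

Lemma forced_set_sub X I : forced_set X I `<=` X.
Proof. by move=> x [c _ []]. Qed.

Lemma kissing_exchangeP X C D I :
  kissing X -> C `<=` unit_sphere R d `\` X -> I `<=` C ->
  kissing ((X `\` D) `|` I) <->
  independent (conflict C) I /\ forced_set X I `<=` D.
Proof.
move=> [Xu Xk] hC IC; split=> [[_ Yk]|[Iind FD]].
  split=> [c c' Ic Ic' [_ _ ncc']|x [c Ic [Xx]]].
    by apply/negP; rewrite -leNgt; apply: Yk => //; right.
  (* If [x] were outside [D], both [c] and [x] would lie in the new configuration; they are distinct
     because [C] avoids [X]. *)
  apply: contraPP => nDx; apply/negP; rewrite -leNgt.
  apply: Yk; [by right|by left|] => cx.
  by have [_] := hC _ (IC _ Ic); rewrite cx.
have clash x c : (X `\` D) x -> I c -> dot c x <= 1 / 2.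
  move=> [Xx nDx] Ic; rewrite leNgt; apply/negP => cx.
  by apply: nDx; apply: FD; exists c.
split=> [x [[Xx _]|/IC/hC[]//]|x y]; first exact: Xu.
(* Two retained points are controlled by [X], a mixed pair by [clash], two inserted points by
   independence. *)
move=> [Xx|Ix] [Xy|Iy] nxy.
- by apply: Xk nxy; [case: Xx|case: Xy].
- by rewrite dotC; exact: clash.
- exact: clash.
- rewrite leNgt; apply/negP => xy.
  by apply: (Iind x y) => //; split => //; exact: IC.
Qed.

End Exchange.

Theorem proposition5p1 (R : realType) (d : nat) (X C : set 'rV[R]_d)
    (hX : kissing X) (hCfin : finite_set C)
    (hC : C `<=` unit_sphere R d `\` X) :
  [/\ forall D I : set 'rV[R]_d, D `<=` X -> I `<=` C ->
        (kissing ((X `\` D) `|` I) <->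
         independent (conflict C) I /\ forced_set X I `<=` D),
      forall I : set 'rV[R]_d, I `<=` C -> independent (conflict C) I ->
        let XI := (X `\` forced_set X I) `|` I in
        is_largest (kissing_exchanges X I) XI /\
        (set_card XI)%:Z - (set_card X)%:Z = (set_card I)%:Z - (set_card (forced_set X I))%:Z
    & forall w : 'rV[R]_d -> R, (forall a, (X `|` C) a -> 0 < w a) ->
      forall I : set 'rV[R]_d, I `<=` C -> independent (conflict C) I ->
        is_maximum
          [set weight w ((X `\` D) `|` I) - weight w X |
             D in [set D | D `<=` X /\ kissing ((X `\` D) `|` I)]]
          (weight w I - weight w (forced_set X I))].
Proof.
have Xfin := kissing_finite hX.
have FX I := @forced_set_sub R d X I.
have Ffin I : finite_set (forced_set X I) := sub_finite_set (FX I) Xfin.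
have XI0 I : I `<=` C -> X `&` I = set0.
  by move=> IC; rewrite -subset0 => x [Xx /IC/hC[]].
have XIkiss I : I `<=` C -> independent (conflict C) I ->
    kissing ((X `\` forced_set X I) `|` I).
  by move=> IC Iind; apply: (kissing_exchangeP _ hX hC IC).2; split=> //; exact: subset_refl.
split=> [D I _ IC|I IC Iind XI|w wpos I IC Iind].
- exact: kissing_exchangeP.
- have Ifin := sub_finite_set IC hCfin.
  have XIfin : finite_set XI by exact: kissing_finite (XIkiss _ _ _).
  split; last first.
    (* In the naturals: |X_I| + |F(I)| = |X| + |I|. *)
    have := @fsbig_exchange _ _ addn _ _ _ _
                (fun=> 1%N) Xfin Ifin (FX I) (XI0 _ IC).
    rewrite /= -!set_cardE // -/XI; lia.
  split; first by split; [exact: XIkiss|exists (forced_set X I)].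
  move=> Y [Yk [D DX YE]].
  (* Every competitor removes at least F(I), hence is contained in [XI]; the strict cardinality
     bound follows from this inclusion. *)
  have YXI : Y `<=` XI.
    rewrite YE in Yk *; have [_ FD] := (kissing_exchangeP _ hX hC IC).1 Yk.
    by apply: setUSS => //; exact: setDS.
  by split=> //; exact: ltn_set_card.
- have Ifin := sub_finite_set IC hCfin.
  (* The gain depends on [D] only through -w(D), so maximizing it means minimizing w(D). *)
  have gain D : D `<=` X ->
      weight w ((X `\` D) `|` I) - weight w X = weight w I - weight w D.
    move=> DX; have := @fsbig_exchange _ _ +%R _ _ _ _ w Xfin Ifin DX (XI0 _ IC).
    rewrite -/(weight w _) /weight /=; lra.
  split; first by exists (forced_set X I); [split=> //; exact: XIkiss|exact: gain].
  move=> _ [D [DX Dk] <-]; rewrite gain // lerD2l lerN2.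
  have [_ FD] := (kissing_exchangeP _ hX hC IC).1 Dk.
  (* The excess w(D) - w(F(I)) is the weight of D \ F(I), a subset of [X], where [w] is positive. *)
  rewrite /weight (@fsbig_setD_sub _ _ +%R _ _ _ w (sub_finite_set DX Xfin) FD) /= lerDl.
  by apply: fsumr_ge0 => a [/DX Xa _]; apply/ltW/wpos; left.
Qed.
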